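(* Assume the Axiom of Choice. Let $X,Y$ be nonempty sets and let $F\colon X^*\to Y$ be a function. The following assertions are equivalent. (i) $F$ is strongly B-preassociative. (ii) There exist an associative, length-preserving and strongly B-preassociative function $H\colon X^*\to X^*$ and a sequence $(f_n)_{n\geqslant 1}$ of one-to-one functions $f_n\colon\mathrm{ran}(H_n)\to Y$ such that $F_n=f_n\circ H_n$ for every $n\geqslant 1$. If condition (ii) holds, then for every $n\geqslant 1$ we have $f_n=F|_{\mathrm{ran}(H_n)}=F_n|_{\mathrm{ran}(H_n)}$, $f_n^{-1}\in Q(F_n)$, and we may choose $H_n=g_n\circ F_n$ for any $g_n\in Q(F_n)$ (that is, for any choice of $g_n\in Q(F_n)$, $n\geqslant 1$, the function $H$ with $H(\varepsilon)=\varepsilon$ and $H_n=g_n\circ F_n$ for all $n\geqslant 1$ satisfies (ii) for suitable $f_n$).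
   Context: $X^*=\bigcup_{n\geqslant 0}X^n$ is the set of all strings (finite words) over $X$, with $X^0=\{\varepsilon\}$, $\varepsilon$ being the empty string; juxtaposition is concatenation and $|\mathbf{x}|$ is the length of $\mathbf{x}$. For a function $F$ on $X^*$, $F_n=F|_{X^n}$ is its $n$-ary part. For $\mathbf{x}=x_1\cdots x_n\in X^n$ and $K\subseteq\{1,\ldots,n\}$, $\mathbf{x}|_K$ is the string obtained from $\mathbf{x}$ by removing all letters $x_i$ with $i\notin K$. $\mathrm{ran}$ and $\mathrm{dom}$ denote range and domain. A function $F$ defined on $X^*$ (with any codomain) is strongly B-preassociative if for every $\mathbf{x}\in X^*$, every $\mathbf{x}'\in X^{|\mathbf{x}|}$ and every $K\subseteq\{1,\ldots,|\mathbf{x}|\}$ with complement $K^c$: $F(\mathbf{x}|_K)=F(\mathbf{x}'|_K)$ and $\mathbf{x}'|_{K^c}=\mathbf{x}|_{K^c}$ imply $F(\mathbf{x})=F(\mathbf{x}')$. A function $H\colon X^*\to X^*$ is associative if $H(\mathbf{x}\mathbf{y}\mathbf{z})=H(\mathbf{x}H(\mathbf{y})\mathbf{z})$ for all $\mathbf{x},\mathbf{y},\mathbf{z}\in X^*$, and length-preserving if $|H(\mathbf{x})|=|\mathbf{x}|$ for every $\mathbf{x}\in X^*$. A function $g$ is a quasi-inverse of a function $f$ if $f\circ g|_{\mathrm{ran}(f)}=\mathrm{id}_{\mathrm{ran}(f)}$ and $\mathrm{ran}(g|_{\mathrm{ran}(f)})=\mathrm{ran}(g)$ (so $\mathrm{ran}(f)\subseteq\mathrm{dom}(g)$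 and $g$ takes values in $\mathrm{dom}(f)$). $Q(f)$ denotes the set of all quasi-inverses of $f$. *)

(* Defs.v *)
From mathcomp Require Import all_boot all_classical.

Set Implicit Arguments.
Unset Strict Implicit.
Unset Printing Implicit Defensive.

Local Open Scope classical_set_scope.

(* A function with a prescribed domain and range is encoded as a map            *)
(* f : A -> option B, with f x = None outside the domain.  Two such maps are    *)
(* =1 iff they have the same domain and the same values there.  Composition is  *)
(* ssrfun's pcomp.                                                              *)
Section PartialFunctions.
Variables A B : Type.
Implicit Types (f : A -> option B) (g : B -> option A) (C : set A).

Definition pdom f : set A := [set x | exists y, f x = Some y].

Definition pran f : set B := [set y | exists x, f x = Some y].

Definition prestr f C : A -> option B := fun x => if x \in C then f x else None.

Definition one_to_one f :=
  forall x x' y, f x = Some y -> f x' = Some y -> x = x'.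

(* The inverse of f, with domain pran f, when f is one-to-one. *)
Definition pinverse f : B -> option A := fun y =>
  if pselect (exists x, f x = Some y) is left ex then Some (projT1 (cid ex))
  else None.

End PartialFunctions.

Definition ptotal (A B : Type) (f : A -> B) : A -> option B := fun x => Some (f x).

Definition pid (A : Type) (C : set A) : A -> option A := prestr (ptotal id) C.

Definition quasi_inverses (A B : Type) (f : A -> option B) :
    set (B -> option A) :=
  [set g | [/\ pran f `<=` pdom g,
               pran g `<=` pdom f,
               pcomp f (prestr g (pran f)) =1 pid (pran f)
             & pran (prestr g (pran f)) = pran g]].

Section Strings.
Variable X : Type.

Definition arity_part (T : Type) (F : seq X -> T) (n : nat) :
    seq X -> option T :=
  prestr (ptotal F) [set x | size x = n].

(* enum K lists the elements of K in increasing order. *)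
Definition substring (n : nat) (x : n.-tuple X) (K : {set 'I_n}) : seq X :=
  [seq tnth x i | i <- enum K].

Definition strongly_B_preassociative (T : Type) (F : seq X -> T) :=
  forall (n : nat) (x x' : n.-tuple X) (K : {set 'I_n}),
    F (substring x K) = F (substring x' K) ->
    substring x' (~: K)%SET = substring x (~: K)%SET ->
    F x = F x'.

Definition string_associative (H : seq X -> seq X) :=
  forall x y z, H (x ++ y ++ z) = H (x ++ H y ++ z).

Definition length_preserving (H : seq X -> seq X) :=
  forall x, size (H x) = size x.

(* The index n = 0 of the sequence f is never constrained. *)
Definition factorization (Y : Type) (F : seq X -> Y) (H : seq X -> seq X)
    (f : nat -> seq X -> option Y) :=
  [/\ string_associative H,
      length_preserving H,
      strongly_B_preassociative H
    & forall n, (1 <= n)%N ->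
        [/\ pdom (f n) = pran (arity_part H n),
            one_to_one (f n)
          & arity_part F n =1 pcomp (f n) (arity_part H n)]].

End Strings.

(* Main.v *)
Require Import Defs.
From mathcomp Require Import all_boot all_classical.

(** Write [H = g o F] arity-wise, for quasi-inverses [g].  Then [F (H s) = F s]
    and [|H s| = |s|], and [H s] depends only on [|s|] and [F s]; so [F] and [H]
    have the same kernel on each arity.  Strong B-preassociativity only refers to
    these kernels, hence passes between [F] and [H], and it gives
    [F (x y z) = F (x (H y) z)], from which associativity of [H] follows. *)

Set Implicit Arguments.
Unset Strict Implicit.

Local Open Scope classical_set_scope.

(** * Partial functions and quasi-inverses *)

Lemma prestrP (A B : Type) (f : A -> option B) (C : set A) x y :
  prestr f C x = Some y <-> C x /\ f x = Some y.
Proof.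
rewrite /prestr; case: ifPn => [/set_mem Cx | /negP nCx]; first by split=> [|[]].
by split=> // -[Cx]; case: nCx; exact: mem_set.
Qed.

Lemma pcompP (A B C : Type) (f : B -> option C) (g : A -> option B) x z :
  pcomp f g x = Some z <-> exists2 y, g x = Some y & f y = Some z.
Proof.
rewrite /pcomp; case: (g x) => [y|] /=; last by split=> // -[].
by split=> [fyz | [_ [<-]]]; first by exists y.
Qed.

Lemma eq_option_Some (A B : Type) (f g : A -> option B) :
  (forall x y, f x = Some y <-> g x = Some y) -> f =1 g.
Proof.
move=> fg x; case fx: (f x) => [y|]; first by apply/esym/fg.
by case gx: (g x) => [y|] //; move/fg: gx; rewrite fx.
Qed.

Lemma pinverse_Some (A B : Type) (f : A -> option B) x y :
  pinverse f y = Some x -> f x = Some y.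
Proof.
by rewrite /pinverse; case: pselect => // ex [<-]; case: (cid ex).
Qed.

Lemma pdom_pinverse (A B : Type) (f : A -> option B) :
  pdom (pinverse f) = pran f.
Proof.
apply/seteqP; split=> y /= [x]; first by move=> gy; exists x; exact: pinverse_Some.
move=> fxy; rewrite /pdom /pinverse /=; case: pselect => [ex|[]]; last by exists x.
by exists (projT1 (cid ex)).
Qed.

(** A choice of preimages defined exactly on the range of [f] takes its values in [pdom f], and
    restricting it to [pran f] changes nothing. *)
Lemma quasi_inversesP (A B : Type) (f : A -> option B) (g : B -> option A) :
  pdom g = pran f -> (forall x y, g y = Some x -> f x = Some y) ->
  quasi_inverses f g.
Proof.
move=> dg gf.
have rg y x : g y = Some x -> pran f y by move=> gy; exists x; exact: gf.
split.
- by rewrite dg.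
- by move=> x [y /gf]; exists y.
- apply: eq_option_Some => y y'; split.
    move=> /pcompP[x /prestrP[ry /gf fx]]; rewrite fx => -[<-].
    exact/prestrP.
  move=> /prestrP[ry [<-]]; apply/pcompP.
  move: (ry); rewrite -{1}dg => -[x gy]; exists x; last exact: gf.
  exact/prestrP.
- apply/seteqP; split=> x [y]; first by move=> /prestrP[_ gy]; exists y.
  by move=> gy; exists y; apply/prestrP; split=> //; exact: rg gy.
Qed.

(** This is where choice enters: [cid] selects a preimage for each point of the range, whether or
    not [f] is one-to-one. *)
Lemma pinverse_quasi_inverse (A B : Type) (f : A -> option B) :
  quasi_inverses f (pinverse f).
Proof. exact: quasi_inversesP (pdom_pinverse f) (@pinverse_Some _ _ f). Qed.

Lemma quasi_inverse_at (A B : Type) (f : A -> option B) (g : B -> option A) x y :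
  quasi_inverses f g -> f x = Some y ->
  exists2 x', g y = Some x' & f x' = Some y.
Proof.
move=> [_ _ fgE _] fxy.
have ry : pran f y by exists x.
have /pcompP[x' /prestrP[_ gy] fx'] : pcomp f (prestr g (pran f)) y = Some y.
  by rewrite fgE; apply/prestrP.
by exists x'.
Qed.

(** * Arity parts, substrings and strong B-preassociativity *)

Section Strings.
Variable X : Type.
Implicit Types (s t x y z : seq X).

Lemma arity_partP (T : Type) (F : seq X -> T) n s u :
  arity_part F n s = Some u <-> size s = n /\ F s = u.
Proof. by split=> [/prestrP[? [?]]|[? <-]] //; apply/prestrP. Qed.

Lemma pran_arity_part (T : Type) (F : seq X -> T) n u :
  pran (arity_part F n) u <-> exists2 s, size s = n & F s = u.
Proof.
by split=> [[s /arity_partP[? ?]]|[s ? ?]]; exists s => //; apply/arity_partP.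
Qed.

(** Masks split along concatenations, which makes substrings of [x ++ y ++ z] computable. *)
Lemma substring_mask n (x : n.-tuple X) (K : {set 'I_n}) :
  substring x K = mask [seq i \in K | i <- enum 'I_n] x.
Proof.
rewrite /substring -[in RHS](map_tnth_enum x) -map_mask -filter_mask.
by rewrite enumT.
Qed.

Lemma size_substring n (x : n.-tuple X) (K : {set 'I_n}) :
  size (substring x K) = #|K|.
Proof. by rewrite size_map -cardE. Qed.

Lemma substring_setT n (x : n.-tuple X) : substring x [set: 'I_n]%SET = x.
Proof. by rewrite /substring enum_setT -enumT map_tnth_enum. Qed.

Lemma substring_nth_mask n (x : n.-tuple X) (b : bitseq) :
  size b = n ->
  substring x [set i : 'I_n | nth false b i]%SET = mask b x /\
  substring x (~: [set i : 'I_n | nth false b i])%SET = mask (map negb b) x.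
Proof.
move=> sb; have bE : [seq nth false b (val i) | i <- enum 'I_n] = b.
  apply: (@eq_from_nth _ false); rewrite size_map size_enum_ord // => i lt_in.
  by rewrite (nth_map (Ordinal lt_in)) ?size_enum_ord //= nth_enum_ord.
rewrite !substring_mask; split; congr mask.
  by rewrite -[RHS]bE; apply: eq_map => i; rewrite inE.
by rewrite -[in RHS]bE -map_comp; apply: eq_map => i; rewrite !inE.
Qed.

(** Take for [K] the positions of the middle block: the substrings on [K] are [y] and [y'], and both
    substrings on the complement are [x ++ z]. *)
Lemma strongly_B_preassociative_factor (T : Type) (F : seq X -> T) x y y' z :
  strongly_B_preassociative F -> size y = size y' -> F y = F y' ->
  F (x ++ y ++ z) = F (x ++ y' ++ z).
Proof.
move=> sF sy Fy.
(* The two strings must be tuples of one common length; [sE] casts the second. *)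
have sE : size (x ++ y' ++ z) == size (x ++ y ++ z) by rewrite !size_cat sy.
pose b := nseq (size x) false ++ nseq (size y) true ++ nseq (size z) false.
have sb : size b = size (x ++ y ++ z) by rewrite !size_cat !size_nseq.
have [m1 c1] := substring_nth_mask (in_tuple (x ++ y ++ z)) sb.
have [m2 c2] := substring_nth_mask (Tuple sE) sb.
have mE v : size v = size y -> mask b (x ++ v ++ z) = v.
  move=> sv; rewrite !mask_cat ?size_nseq //.
  by rewrite !mask_false mask_true ?sv // cats0.
have cE v : size v = size y -> mask (map negb b) (x ++ v ++ z) = x ++ z.
  move=> sv; rewrite !map_cat !map_nseq !mask_cat ?size_nseq //.
  by rewrite !mask_true // mask_false.
have := sF _ (in_tuple (x ++ y ++ z)) (Tuple sE)
  [set i : 'I_(size (x ++ y ++ z)) | nth false b i]%SET.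
by rewrite m1 m2 c1 c2 /= !mE // !cE // => /(_ Fy erefl).
Qed.

(** Kernels are compared on nonempty strings only, since a factorization says nothing about [F] in
    arity 0. *)
Lemma strongly_B_preassociative_ker (T U : Type) (F : seq X -> T)
    (H : seq X -> U) :
  (forall s t, size s = size t -> (0 < size s)%N -> (F s = F t <-> H s = H t)) ->
  strongly_B_preassociative F -> strongly_B_preassociative H.
Proof.
move=> FH sF n x x' K HK xK.
(* If [K] is empty, its complement is everything and [x = x']; otherwise the substrings on [K] are
   nonempty and the kernels can be exchanged. *)
have [K0 | [i iK]] := set_0Vmem K.
  by move: xK; rewrite K0 finset.setC0 !substring_setT => ->.
have n0 : (0 < n)%N := leq_ltn_trans (leq0n i) (ltn_ord i).
apply/FH; rewrite ?size_tuple //; apply: sF xK.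
by apply/FH; rewrite ?size_substring //; apply/card_gt0P; exists i.
Qed.

(** * Consequences of a given factorization *)

Section Factorization.
Variables (Y : Type) (F : seq X -> Y) (H : seq X -> seq X)
  (f : nat -> seq X -> option Y).
Hypothesis fact : factorization F H f.

Let sizeH : length_preserving H. Proof. by case: fact. Qed.

Lemma factorizationE s : (0 < size s)%N -> f (size s) (H s) = Some (F s).
Proof.
case: fact => _ _ _ /[apply] -[_ _ FE].
have /pcompP[t /arity_partP[_ <-] //] :
  pcomp (f (size s)) (arity_part H (size s)) s = Some (F s).
by rewrite -FE; apply/arity_partP.
Qed.

(** Associativity with empty outer strings makes [H] idempotent, so a [t] in the range satisfies
    [H t = t], and [f n t = f n (H t) = F t]. *)
Lemma factorization_Some n t u : (0 < n)%N ->
  f n t = Some u <-> pran (arity_part H n) t /\ F t = u.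
Proof.
move=> n0; case: fact => Hassoc _ _ /(_ n n0)[domf _ _].
have HH s : H (H s) = H s.
  by have := Hassoc [::] s [::]; rewrite /= !cats0 => <-.
have fF s : pran (arity_part H n) s -> f n s = Some (F s).
  move=> /pran_arity_part[v sv <-].
  by rewrite -{1}HH -sv -(sizeH v) factorizationE // sizeH sv.
split=> [ft | [rt <-]]; last exact: fF.
have rt : pran (arity_part H n) t by rewrite -domf; exists u.
by split=> //; move: ft; rewrite fF // => -[].
Qed.

(** Each [f n] with [n >= 1] is one-to-one, so [F] and [H] identify the same nonempty strings of
    equal length. *)
Lemma factorization_strongly_B_preassociative : strongly_B_preassociative F.
Proof.
case: (fact) => _ _ sH ff; apply: strongly_B_preassociative_ker sH.
move=> s t st s0.
have fs := factorizationE s0; have := s0; rewrite st => /factorizationE.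
rewrite -st => ft; split=> [Hst | Fst].
  by move: fs; rewrite Hst ft => -[].
by have [_ inj _] := ff _ s0; apply: inj fs _; rewrite ft Fst.
Qed.

Lemma factorization_restr n : (0 < n)%N ->
  f n =1 prestr (arity_part F n) (pran (arity_part H n)).
Proof.
move=> n0; apply: eq_option_Some => t u; rewrite factorization_Some //.
split=> [[rt Ft] | /prestrP[rt /arity_partP[]//]].
apply/prestrP; split=> //; apply/arity_partP; split=> //.
by case/pran_arity_part: rt => v <- <-.
Qed.

(** The range of [f n] is that of the arity part of [F], and preimages under [f n], a restriction of
    that part, are preimages under it. *)
Lemma factorization_pinverse n : (0 < n)%N ->
  quasi_inverses (arity_part F n) (pinverse (f n)).
Proof.
move=> n0; apply: quasi_inversesP.
  rewrite pdom_pinverse; apply/seteqP; split=> u.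
    by move=> [t]; rewrite factorization_restr // => /prestrP[_]; exists t.
  move=> /pran_arity_part[s sn <-]; exists (H s).
  by rewrite -sn factorizationE // sn.
by move=> t u gt; have := pinverse_Some gt; rewrite factorization_restr // => /prestrP[].
Qed.

End Factorization.

(** * Construction of a factorization from quasi-inverses *)

Lemma factorization_of_quasi_inverses (Y : Type) (F : seq X -> Y)
    (g : nat -> Y -> option (seq X)) :
  strongly_B_preassociative F ->
  (forall n, (0 < n)%N -> quasi_inverses (arity_part F n) (g n)) ->
  exists (H : seq X -> seq X) (f : nat -> seq X -> option Y),
    [/\ H [::] = [::],
        forall n, (0 < n)%N -> arity_part H n =1 pcomp (g n) (arity_part F n)
      & factorization F H f].
Proof.
move=> sF gF.
(* The [odflt] default is never reached: [g n] is defined on the whole range of the arity part for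
   [n >= 1]. *)
pose H s := if s is [::] then [::] else odflt [::] (g (size s) (F s)).
have HE s : (0 < size s)%N ->
    [/\ g (size s) (F s) = Some (H s), size (H s) = size s & F (H s) = F s].
  move=> s0; have /(quasi_inverse_at (gF _ s0)) :
    arity_part F (size s) s = Some (F s) by apply/arity_partP.
  by case: s s0 => //= a s _ [t gt /arity_partP[st Ft]]; rewrite gt.
have sizeH : length_preserving H.
  by case=> // a s; have [] := HE (a :: s) isT.
have FH s : F (H s) = F s.
  by case: s => // a s; have [] := HE (a :: s) isT.
have ker s t : size s = size t -> F s = F t <-> H s = H t.
  move=> st; split=> [Fst | Hst]; last by rewrite -FH Hst FH.
  case: s t st Fst => [|a s] [|b t] // st Fst.
  by rewrite /H st Fst.
(* By [factorization_Some] this is the only possible [f n] for [n >= 1]. *)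
exists H, (fun n => prestr (ptotal F) (pran (arity_part H n))); split=> //.
  move=> n n0; apply: eq_option_Some => s t; split.
    move=> /arity_partP[sn <-]; apply/pcompP; exists (F s).
      exact/arity_partP.
    by rewrite -sn; have [] := HE s; rewrite ?sn.
  move=> /pcompP[u /arity_partP[sn <-]] gt; apply/arity_partP; split=> //.
  by have [] := HE s; rewrite sn // gt => -[].
split=> //.
(* Both sides have the same length, so it suffices to compare their images under [F], where [y] may
   be replaced by [H y]. *)
- move=> x y z; apply/ker; first by rewrite !size_cat sizeH.
  by apply: strongly_B_preassociative_factor; rewrite ?sizeH ?FH.
- by apply: strongly_B_preassociative_ker sF => s t st _; apply: ker.
move=> n _; split.
- apply/seteqP; split=> t; first by move=> [u /prestrP[]].
  by move=> rt; exists (F t); apply/prestrP.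
(* Write [t = H s] and [t' = H s']: as [F] is unchanged by [H], equal values give [F s = F s'],
   hence [H s = H s']. *)
- move=> t t' u /prestrP[/pran_arity_part[s sn <-] [Fs]].
  move=> /prestrP[/pran_arity_part[s' sn' <-] [Fs']].
  by apply/ker; [rewrite sn sn' | rewrite -(FH s) -(FH s') Fs Fs'].
- apply: eq_option_Some => s u; split.
    move=> /arity_partP[sn <-]; apply/pcompP; exists (H s).
      exact/arity_partP.
    apply/prestrP; split; last by rewrite /ptotal FH.
    by apply/pran_arity_part; exists s.
  move=> /pcompP[t /arity_partP[sn <-] /prestrP[_ [<-]]].
  by apply/arity_partP; rewrite FH.
Qed.

End Strings.

Theorem corollary2p14 (X Y : Type) (hX : inhabited X) (hY : inhabited Y)
    (F : seq X -> Y) :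
  (strongly_B_preassociative F <->
     exists (H : seq X -> seq X) (f : nat -> seq X -> option Y),
       factorization F H f)
  /\ (forall (H : seq X -> seq X) (f : nat -> seq X -> option Y),
        factorization F H f ->
        forall n : nat, (1 <= n)%N ->
          [/\ f n =1 prestr (ptotal F) (pran (arity_part H n)),
              f n =1 prestr (arity_part F n) (pran (arity_part H n))
            & quasi_inverses (arity_part F n) (pinverse (f n))])
  /\ ((exists (H : seq X -> seq X) (f : nat -> seq X -> option Y),
         factorization F H f) ->
      forall g : nat -> Y -> option (seq X),
        (forall n : nat, (1 <= n)%N ->
           quasi_inverses (arity_part F n) (g n)) ->
        exists (H : seq X -> seq X) (f : nat -> seq X -> option Y),
          [/\ H [::] = [::],
              forall n : nat, (1 <= n)%N ->
                arity_part H n =1 pcomp (g n) (arity_part F n)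
            & factorization F H f]).
Proof.
split; [split | split].
- move=> sF; have [|H [f [_ _ fact]]] :=
    factorization_of_quasi_inverses (g := fun n => pinverse (arity_part F n)) sF.
    by move=> n _; exact: pinverse_quasi_inverse.
  by exists H, f.
- by move=> [H [f /factorization_strongly_B_preassociative]].
- move=> H f fact n n0; split.
  + apply: eq_option_Some => t u; rewrite (factorization_Some fact) //.
    by split=> [[? <-] | /prestrP[? [<-]] //]; apply/prestrP.
  + exact: factorization_restr fact _ n0.
  + exact: factorization_pinverse fact _ n0.
- move=> [H [f /factorization_strongly_B_preassociative sF]] g gF.
  exact: factorization_of_quasi_inverses.
Qed.
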